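(* Let $\{G_\alpha:\alpha\text{ is atomic}\}$ be a set of graphs, one for each atomic set partition $\alpha$, such that for each atomic $\alpha\vdash[n]$ ($n\ge1$) the graph $G_\alpha$ has $n$ vertices (with distinct vertex labels in $[n]$) and $\pi(G_\alpha)=\alpha$. Then, for each $n\ge1$, $$\{Y_{G_\pi}:\pi\vdash[n]\}$$ is a $\mathbb{Q}$-basis for $\mathrm{NCSym}^n$. Additionally, all $\{Y_{G_\alpha}:\alpha\text{ is atomic}\}$ are algebraically independent over $\mathbb{Q}$ and freely generate $\mathrm{NCSym}$.
   Context: All graphs are finite and simple. A graph $G$ with distinct vertex labels in $[n]=\{1,\dots,n\}$ is a graph with $n$ vertices labelled bijectively by $1,\dots,n$; write $v_i$ for the vertex labelled $i$. Let $x_1,x_2,\dots$ be noncommuting variables. A proper colouring of $G$ is a map $\kappa$ from the vertices to $\{1,2,\dots\}$ with $\kappa(u)\ne\kappa(v)$ whenever $u,v$ are adjacent. $Y_G=\sum_\kappa x_{\kappa(v_1)}\cdots x_{\kappa(v_n)}\in\mathbb{Q}\langle\langle x_1,x_2,\dots\rangle\rangle$, summed over all proper colourings $\kappa$ of $G$. A set partition $\pi=B_1/\cdots/B_\ell\vdash[n]$ is a family of disjoint nonempty sets (blocks) with union $[n]$. For $\pi\vdash[n]$, $m_\pi=\sum x_{i_1}\cdots x_{i_n}$ over tuples of positive integers with $i_j=i_k$ if and only if $j,k$ are in the same block of $\pi$. $\mathrm{NCSym}=\bigoplus_{n\ge0}\mathrm{NCSym}^n\subset\mathbb{Q}\langle\langle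 x_1,x_2,\dots\rangle\rangle$ is the graded algebra with $\mathrm{NCSym}^0=\mathbb{Q}\cdot1$ and $\mathrm{NCSym}^n=\mathrm{span}_{\mathbb{Q}}\{m_\pi:\pi\vdash[n]\}$ for $n\ge1$. For $\pi\vdash[n]$ and $\sigma=B_1/\cdots/B_\ell\vdash[m]$, the slash product is $\pi\mid\sigma=\pi/(B_1+n)/\cdots/(B_\ell+n)\vdash[n+m]$, where $B+n=\{b+n:b\in B\}$. A nonempty set partition is atomic if it is not $\sigma_1\mid\sigma_2$ for any nonempty set partitions $\sigma_1,\sigma_2$. Every nonempty set partition can be written uniquely as $\pi=\alpha_1\mid\alpha_2\mid\cdots\mid\alpha_k$ with each $\alpha_i$ nonempty and atomic (its atomic decomposition). For graphs $G$ with labels in $[n]$ and $H$ with labels in $[m]$, $G\mid H$ is the disjoint union of $G$ and $H$ labelled by $[n+m]$, where vertices of $G$ keep their labels and the vertex of $H$ labelled $j$ receives the label $n+j$. For a graph $G$ with labels in $[n]$, $\pi(G)\vdash[n]$ is the set partition whose blocks are the sets of labels of the connected components of $G$. Given the chosen graphs $G_\alpha$ for atomic $\alpha$, for general $\pi\vdash[n]$ with atomic decomposition $\pi=\alpha_1\mid\cdots\mid\alpha_k$ put $G_\pi=G_{\alpha_1}\mid G_{\alpha_2}\mid\cdots\mid G_{\alpha_k}$. Generation and independence are in the noncommutative sense: the elements satisfy no nontrivial noncommutative polynomial relation over $\mathbb{Q}$, and $\mathrm{NCSym}$ is the free associative unital $\mathbb{Q}$-algebra on them. *)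

(* Defs.v *)
From HB Require Import structures.
From mathcomp Require Import all_boot all_order all_algebra finmap.
From mathcomp Require Import boolp classical_sets functions cardinality fsbigop.
From mathcomp Require Import monalg.
(* partition, cover, pblock and so on are those on {set T}. *)
Import boot.finset.

Set Implicit Arguments.
Unset Strict Implicit.
Unset Printing Implicit Defensive.
Import GRing.Theory.

(* The label j of [n] = {1, ..., n} is the ordinal j - 1 of 'I_n; a graph     *)
(* labelled by [n] has 'I_n itself as its vertex set.                         *)

Section FiniteCombinatorics.
Local Open Scope nat_scope.

Definition setpart (n : nat) : Type :=
  {P : {set {set 'I_n}} | partition P [set: 'I_n]}.
HB.instance Definition _ n := SubFinite.on (setpart n).

(* Slash products and decompositions change n, hence the union over all n.    *)
Definition partn : Type := {n : nat & setpart n}.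
HB.instance Definition _ := Choice.on partn.

Definition slash_blocks m k (P : {set {set 'I_m}}) (Q : {set {set 'I_k}}) :
    {set {set 'I_(m + k)}} :=
  [set lshift k @: B | B : {set 'I_m} in P]
    :|: [set @rshift m k @: B | B : {set 'I_k} in Q].

Lemma slash_partition m k (P : {set {set 'I_m}}) (Q : {set {set 'I_k}}) :
  partition P [set: 'I_m] -> partition Q [set: 'I_k] ->
  partition (slash_blocks P Q) [set: 'I_(m + k)].
Proof.
move=> /and3P[/eqP cP tP nP] /and3P[/eqP cQ tQ nQ].
have lrdisj (B : {set 'I_m}) (C : {set 'I_k}) :
    [disjoint lshift k @: B & @rshift m k @: C].
  apply/pred0P => x /=; apply/negbTE/negP.
  by case/andP=> /imsetP[a _ ->] /imsetP[b _ /eqP]; rewrite eq_lrshift.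
apply/and3P; split.
- apply/eqP/setP=> x; rewrite inE; apply/bigcupP.
  case: (split_ordP x) => j ->.
  + have: j \in cover P by rewrite cP inE.
    case/bigcupP=> B BP jB; exists (lshift k @: B); last exact: imset_f.
    by rewrite inE imset_f.
  + have: j \in cover Q by rewrite cQ inE.
    case/bigcupP=> B BP jB; exists (@rshift m k @: B); last exact: imset_f.
    by rewrite inE (imset_f (fun B : {set 'I_k} => @rshift m k @: B)) ?orbT.
- apply/trivIsetP=> A B /setUP[] /imsetP[A0 A0P ->] /setUP[] /imsetP[B0 B0P ->].
  + move=> neq; rewrite imset_disjoint; last exact: lshift_inj.
    by apply: (trivIsetP tP) => //; apply: contraNneq neq => ->.
  + by [].
  + by rewrite disjoint_sym.
  + move=> neq; rewrite imset_disjoint; last exact: rshift_inj.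
    by apply: (trivIsetP tQ) => //; apply: contraNneq neq => ->.
- apply/negP=> /setUP[] /imsetP[B BP /esym/eqP]; rewrite imset_eq0 => /eqP B0.
  + by move: nP; rewrite -B0 BP.
  + by move: nQ; rewrite -B0 BP.
Qed.

Definition slash (p q : partn) : partn :=
  existT setpart (tag p + tag q)
    (Sub (slash_blocks (val (tagged p)) (val (tagged q)))
         (slash_partition (valP (tagged p)) (valP (tagged q)))).

Lemma empty_partition : partition set0 [set: 'I_0].
Proof.
rewrite /partition /cover big_set0 inE andbT; apply/andP; split.
  by apply/eqP/setP; case.
by apply/trivIsetP=> A B; rewrite inE.
Qed.

Definition empty_part : partn := existT setpart 0 (Sub set0 empty_partition).

Definition atomic (p : partn) : Prop :=
  0 < tag p /\
  forall s t : partn, 0 < tag s -> 0 < tag t -> p <> slash s t.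

Definition atomic_part : Type := {p : partn | `[< atomic p >]}.
HB.instance Definition _ := SubChoice.on atomic_part.

Definition asize (a : atomic_part) : nat := tag (val a).
Definition apart (a : atomic_part) : setpart (asize a) := tagged (val a).

Definition slash_seq (s : seq atomic_part) : partn :=
  foldr (fun a p => slash (val a) p) empty_part s.

(* Such a list exists, by atomic_decompK below, and it is unique. *)
Definition atomic_decomp (p : partn) : seq atomic_part :=
  xget [::] [set s | slash_seq s = p]%classic.

Let same_block (p : partn) (i j : nat) : bool :=
  [exists B in val (tagged p), exists x in B, exists y in B,
     (val x == i) && (val y == j)].

Let same_blockP (p : partn) (i j : nat) :
  reflect (exists B, B \in val (tagged p) /\
             exists x y, [/\ x \in B, y \in B, val x = i & val y = j])
          (same_block p i j).
Proof.
apply: (iffP exists_inP) => [[B BP /exists_inP[x xB /exists_inP[y yB]]]|].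
  by case/andP=> /eqP xi /eqP yj; exists B; split=> //; exists x, y.
case=> B [BP [x [y [xB yB xi yj]]]]; exists B => //; apply/exists_inP.
by exists x => //; apply/exists_inP; exists y; rewrite // xi yj !eqxx.
Qed.

Let partn_eq (p q : partn) :
  tag p = tag q -> (forall i j, same_block p i j = same_block q i j) -> p = q.
Proof.
have blockE n (P : setpart n) (x y : 'I_n) :
    same_block (existT setpart n P) x y = (y \in finset.pblock (val P) x).
  have /and3P[/eqP cP tP _] := valP P.
  apply/same_blockP/idP => [[B [BP [u [v [uB vB]]]]]|yx].
    by move=> /val_inj <- /val_inj <-; rewrite (def_pblock tP BP uB).
  exists (finset.pblock (val P) x); split; first by rewrite pblock_mem ?cP ?inE.
  by exists x, y; split=> //; rewrite mem_pblock cP inE.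
case: p q => n P [m Q] /= nm; subst m => PQ; congr existT; apply: val_inj.
rewrite -(equivalence_partition_pblock (valP P)).
rewrite -(equivalence_partition_pblock (valP Q)).
apply: eq_imset => x; apply/setP=> y; rewrite !inE /=.
by have := PQ x y; rewrite !blockE.
Qed.

Let same_slash (p q : partn) i j : same_block (slash p q) i j =
  same_block p i j || [&& tag p <= i, tag p <= j &
                         same_block q (i - tag p) (j - tag p)].
Proof.
apply/same_blockP/orP => [[B [/setUP[]/imsetP[C CP ->]]]|[|]].
- case=> x [y [/imsetP[u uC ->] /imsetP[v vC ->] <- <-]]; left.
  by apply/same_blockP; exists C; split=> //; exists u, v.
- case=> x [y [/imsetP[u uC ->] /imsetP[v vC ->] <- <-]]; right.
  rewrite /= !leq_addr !addKn; apply/same_blockP.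
  by exists C; split=> //; exists u, v.
- case/same_blockP=> C [CP [u [v [uC vC <- <-]]]].
  exists (lshift (tag q) @: C); split; first by rewrite inE imset_f.
  by exists (lshift (tag q) u), (lshift (tag q) v); split; rewrite ?imset_f.
- case/and3P=> pi pj /same_blockP[C [CP [u [v [uC vC ui vj]]]]].
  exists (@rshift (tag p) (tag q) @: C); split.
    rewrite inE (imset_f (fun B : {set 'I_(tag q)} => @rshift (tag p) _ @: B)) //.
    by rewrite orbT.
  exists (rshift (tag p) u), (rshift (tag p) v).
  by split; rewrite ?imset_f //= ?ui ?vj subnKC.
Qed.

Lemma slashA : associative slash.
Proof.
move=> p q r; apply: partn_eq => [|i j]; first by rewrite /= addnA.
rewrite !same_slash /= !subnDA -!orbA; congr orb.
case: (leqP (tag p) i) => pi; last first.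
  by rewrite [_ + _ <= i]leqNgt (leq_trans pi) ?leq_addr.
case: (leqP (tag p) j) => pj; last first.
  by rewrite [_ + _ <= j]leqNgt (leq_trans pj) ?leq_addr //= andbF.
by rewrite /= !leq_subRL.
Qed.

Lemma slash0p : left_id empty_part slash.
Proof.
move=> p; apply: partn_eq => // i j; rewrite same_slash /= !subn0.
by case: same_blockP => // -[B []]; rewrite inE.
Qed.

Lemma slash_cat s t : slash_seq (s ++ t) = slash (slash_seq s) (slash_seq t).
Proof. by elim: s => [|a s IH] /=; rewrite ?slash0p // IH slashA. Qed.

Lemma atomic_decompK (p : partn) : slash_seq (atomic_decomp p) = p.
Proof.
suff [s sp] : exists s, slash_seq s = p.
  by rewrite /atomic_decomp; case: xgetP => [? _ //|/(_ s)].
have [n] := ubnP (tag p); elim: n p => // n IH p /ltnSE pn.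
have [p0|p0] := posnP (tag p).
  exists [::]; apply: partn_eq => // i j.
  apply/same_blockP/same_blockP => -[B [_ [x _]]]; first by case: x.
  by case: x => x xp; exfalso; move: xp; rewrite p0.
have [pa|/not_andP[//|]] := EM (atomic p).
  exists [:: exist _ p (introT (asboolP _) pa)] => /=.
  apply: partn_eq => [|i j]; first by rewrite /= addn0.
  rewrite same_slash /=; case: same_blockP => //= npij.
  by case: same_blockP => [[B []]|]; rewrite ?inE ?andbF.
move/existsNP=> [s /existsNP[t /not_implyP[s0 /not_implyP[t0 /contrapT pE]]]].
have tE : tag p = tag s + tag t by rewrite pE.
have [|ss sE] := IH s.
  by apply: leq_trans pn; rewrite tE -addn1 leq_add2l.
have [|tt tE'] := IH t.
  by apply: leq_trans pn; rewrite tE -add1n leq_add2r.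
by exists (ss ++ tt); rewrite slash_cat sE tE' pE.
Qed.

Record sgraph (n : nat) := SGraph {
  adj :> rel 'I_n;
  adj_sym : symmetric adj;
  adj_irr : irreflexive adj }.

Lemma comp_partition n (H : sgraph n) :
  partition (equivalence_partition (connect H) [set: 'I_n]) [set: 'I_n].
Proof.
apply: equivalence_partitionP => x y z _ _ _; split; first exact: connect0.
have sH : connect_sym H by apply: sym_connect_sym; exact: adj_sym.
by move=> xy; apply: same_connect.
Qed.

Definition comp_part n (H : sgraph n) : setpart n :=
  Sub (equivalence_partition (connect H) [set: 'I_n]) (comp_partition H).

Definition slash_adj m k (G : sgraph m) (H : sgraph k) : rel 'I_(m + k) :=
  fun u v => match fintype.split u, fintype.split v with
             | inl a, inl b => G a b
             | inr a, inr b => H a b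
             | _, _ => false
             end.

Lemma slash_adj_sym m k (G : sgraph m) (H : sgraph k) :
  symmetric (slash_adj G H).
Proof.
by move=> u v; rewrite /slash_adj; case: fintype.split => a; case: fintype.split => b //;
  exact: adj_sym.
Qed.

Lemma slash_adj_irr m k (G : sgraph m) (H : sgraph k) :
  irreflexive (slash_adj G H).
Proof. by move=> u; rewrite /slash_adj; case: fintype.split => a; exact: adj_irr. Qed.

Definition slash_graph m k (G : sgraph m) (H : sgraph k) : sgraph (m + k) :=
  SGraph (slash_adj_sym G H) (slash_adj_irr G H).

Definition empty_graph : sgraph 0 :=
  @SGraph 0 (fun _ _ => false) (fun _ _ => erefl) (fun _ => erefl).

Fixpoint seq_graph (G : forall a : atomic_part, sgraph (asize a))
    (s : seq atomic_part) : sgraph (tag (slash_seq s)) :=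
  match s with
  | [::] => empty_graph
  | a :: s' => slash_graph (G a) (seq_graph G s')
  end.

Definition extend_graph (G : forall a : atomic_part, sgraph (asize a))
    (p : partn) : sgraph (tag (slash_seq (atomic_decomp p))) :=
  seq_graph G (atomic_decomp p).

End FiniteCombinatorics.

Local Open Scope classical_set_scope.
Local Open Scope ring_scope.

(* Q<<x_1, x_2, ...>>: coefficient functions on words; the letter i : nat     *)
(* stands for x_(i+1).                                                        *)
Definition ncseries := seq nat -> rat.
HB.instance Definition _ := GRing.Lmodule.copy ncseries (seq nat -> rat^o).

Definition nc_monomial (w : seq nat) : ncseries := fun v => (v == w)%:R.

Definition nc_mul (f g : ncseries) : ncseries :=
  fun w => \sum_(i < (size w).+1) f (take i w) * g (drop i w).

Section NCRing.
Implicit Types f g h : ncseries.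

Let shift (x : nat) f : ncseries := fun w => f (x :: w).

Let mul_nil f g : nc_mul f g [::] = f [::] * g [::].
Proof. by rewrite /nc_mul big_ord1. Qed.

Let mul_cons f g x w :
  nc_mul f g (x :: w) = f [::] * g (x :: w) + nc_mul (shift x f) g w.
Proof. by rewrite /nc_mul big_ord_recl take0 drop0. Qed.

Let nc_mulDl : left_distributive nc_mul +%R.
Proof.
move=> f g h; apply/funext => w; rewrite /nc_mul -[RHS]big_split /=.
by apply: eq_bigr => i _; rewrite -mulrDl.
Qed.

Let nc_mulDr : right_distributive nc_mul +%R.
Proof.
move=> f g h; apply/funext => w; rewrite /nc_mul -[RHS]big_split /=.
by apply: eq_bigr => i _; rewrite -mulrDr.
Qed.

Let nc_mulAl (c : rat) f g : c *: nc_mul f g = nc_mul (c *: f) g.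
Proof.
apply/funext => w; rewrite /nc_mul.
transitivity (c * \sum_(i < (size w).+1) f (take i w) * g (drop i w)) => //.
by rewrite big_distrr; apply: eq_bigr => i _; rewrite /= mulrA.
Qed.

Let nc_mulAr (c : rat) f g : c *: nc_mul f g = nc_mul f (c *: g).
Proof.
apply/funext => w; rewrite /nc_mul.
transitivity (c * \sum_(i < (size w).+1) f (take i w) * g (drop i w)) => //.
by rewrite big_distrr; apply: eq_bigr => i _; rewrite /= mulrCA.
Qed.

Let shift_mul x f g :
  shift x (nc_mul f g) = f [::] *: shift x g + nc_mul (shift x f) g.
Proof. by apply/funext => w; rewrite /shift mul_cons. Qed.

Let nc_mulA : associative nc_mul.
Proof.
move=> f g h; apply/funext => w; elim: w f g h => [|x w IH] f g h.
  by rewrite !mul_nil mulrA.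
rewrite !mul_cons mul_nil shift_mul nc_mulDl -nc_mulAl IH mulrDr.
by rewrite -addrA mulrA.
Qed.

Let nc_mul1 : left_id (nc_monomial [::]) nc_mul.
Proof.
move=> f; apply/funext => -[|x w]; first by rewrite mul_nil mul1r.
rewrite mul_cons mul1r /nc_mul big1 ?addr0 // => i _.
by rewrite /shift /nc_monomial mul0r.
Qed.

Let nc_mulr1 : right_id (nc_monomial [::]) nc_mul.
Proof.
move=> f; apply/funext => w; elim: w f => [|x w IH] f.
  by rewrite mul_nil mulr1.
by rewrite mul_cons IH mulr0 add0r.
Qed.

Let nc_one_neq0 : nc_monomial [::] != 0.
Proof. by apply/eqP => /(congr1 (fun f : ncseries => f [::])). Qed.

HB.instance Definition _ := GRing.Zmodule_isNzRing.Build ncseries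
  nc_mulA nc_mul1 nc_mulr1 nc_mulDl nc_mulDr nc_one_neq0.
HB.instance Definition _ := GRing.Lmodule_isLalgebra.Build rat ncseries nc_mulAl.
HB.instance Definition _ := GRing.Lalgebra_isAlgebra.Build rat ncseries nc_mulAr.

End NCRing.

(* Coefficientwise sum of a (possibly infinite) locally finite family. *)
Definition nc_sum (I : choiceType) (A : set I) (F : I -> ncseries) : ncseries :=
  fun w => \sum_(i \in A) F i w.

Definition proper_colouring n (H : sgraph n) (k : {ffun 'I_n -> nat}) : Prop :=
  forall u v : 'I_n, H u v -> k u <> k v.

Definition chromY n (H : sgraph n) : ncseries :=
  nc_sum [set k | proper_colouring H k]
         (fun k => nc_monomial [seq k j | j <- enum 'I_n]).

Definition mpart n (p : setpart n) : ncseries :=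
  nc_sum [set i : {ffun 'I_n -> nat} |
            forall j k : 'I_n, i j = i k <-> k \in pblock (val p) j]
         (fun i => nc_monomial [seq i j | j <- enum 'I_n]).

Section Linear.
Variables (V : lmodType rat) (I : finType).
Implicit Type v : I -> V.

Definition lin_span v : set V := [set \sum_i c i *: v i | c in [set: I -> rat]].

Definition lin_indep v : Prop :=
  forall c : I -> rat, \sum_i c i *: v i = 0 -> forall i, c i = 0.

Definition is_basis v (S : set V) : Prop := lin_indep v /\ lin_span v = S.

End Linear.

Definition NCSym_deg (n : nat) : set ncseries :=
  if n is 0 then [set c%:A | c in [set: rat]] else lin_span (@mpart n).

(* Homogeneous pieces of distinct degrees are independent, so the direct sum  *)
(* is the set of finite sums.                                                 *)
Definition NCSym : set ncseries :=
  [set f | exists (N : nat) (g : nat -> ncseries),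
     (forall n, NCSym_deg n (g n)) /\ f = \sum_(n < N) g n].

Section FreeAlgebra.
Variables (A : algType rat) (I : choiceType) (y : I -> A).

(* {malg rat[{fmonom I}]}, the monoid algebra of the free monoid on I, is the *)
(* free algebra Q<X_i | i in I>; nc_eval substitutes y i for X_i.             *)
Definition nc_eval_word (w : {fmonom I}) : A := \prod_(i <- fmonom_val w) y i.

Definition nc_eval (p : {malg rat[{fmonom I}]}) : A :=
  mmap (in_alg A) nc_eval_word p.

Let nc_eval_word_mmorphism : mmorphism nc_eval_word.
Proof.
by split=> [v w|]; rewrite /nc_eval_word ?fmM ?fm1 ?big_cat ?big_nil.
Qed.
HB.instance Definition _ := isMultiplicative.Build {fmonom I} A nc_eval_word
  nc_eval_word_mmorphism.
HB.instance Definition _ := GRing.Additive.copy nc_eval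
  (mmap (in_alg A) nc_eval_word).

Let nc_eval_multiplicative : GRing.monoid_morphism nc_eval.
Proof.
have [] : multiplicative nc_eval.
  apply: commr_mmap_is_multiplicative => g v w.
  by rewrite /GRing.comm /= mulr_algl mulr_algr.
by split.
Qed.
HB.instance Definition _ := GRing.isMonoidMorphism.Build _ _ nc_eval
  nc_eval_multiplicative.

Let nc_eval_scalable : scalable nc_eval.
Proof. by move=> c p; rewrite /nc_eval mmapZ /= mulr_algl. Qed.
HB.instance Definition _ := GRing.isScalable.Build rat {malg rat[{fmonom I}]} A
  *:%R nc_eval nc_eval_scalable.

Lemma nc_evalX i : nc_eval << fmu i >> = y i.
Proof. by rewrite /nc_eval mmapU /= mulr_algl scale1r /nc_eval_word fmU big_seq1. Qed.

Definition alg_indep : Prop := forall p, nc_eval p = 0 -> p = 0.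

(* S is the free associative unital algebra on the y i. *)
Definition freely_generate (S : set A) : Prop := set_bij [set: _] S nc_eval.

End FreeAlgebra.

(* Main.v *)
(* Expanding the product of 1 - [k u = k v] over the edges writes Y_H as a    *)
(* combination of power sums p_tau, where tau is the partition into components*)
(* of a set S of edges and the coefficient of p_tau is the sum of (-1)^|S| over*)
(* the S with components tau. Only tau refining pi(H) occur, and the          *)
(* coefficient at tau = pi(H) is nonzero: by deletion-contraction its sign is *)
(* (-1)^(n - number of components). So graphs H_pi with pi(H_pi) = pi give Y's*)
(* that are triangular in the power sums, hence a basis of NCSym^n.           *)
(* As Y_{G | H} = Y_G Y_H, monomials in the Y_{G_alpha} are the Y_{G_pi}, each*)
(* obtained once because atomic decompositions are unique.                    *)
From mathcomp Require Import all_boot all_order all_algebra finmap.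
From mathcomp Require Import boolp classical_sets fsbigop.
From mathcomp Require Import monalg.
Import boot.finset.
Require Import Defs.
Set Implicit Arguments.
Unset Strict Implicit.
Unset Printing Implicit Defensive.
Import Order.TTheory GRing.Theory Num.Theory.

(** The linear core is [proper_indep]: if [H p] has component partition [p], the indicators of
    proper colourings of the graphs [H p] are linearly independent. Inclusion-exclusion over edge
    sets ([properE]) factors the matrix of these indicators, with colourings taken up to their
    kernels, into two matrices triangular for refinement: the coefficients [psum_coef] and the
    refinement matrix itself. The only diagonal entry that takes work is [psum_coef_comp_part], the
    signed count of edge sets with the same components as [H]. With one root fixed per component it
    becomes [reach_sum], whose sign deletion-contraction determines ([reach_sum_gt0]).

    Spanning then follows by counting: every Y lies in the span of the m's ([chromY_mpart]), and
    both families are indexed by the set partitions of [n], so independence forces equal spans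
    ([lin_span_eq]).

    For free generation, [chromY_slash] makes a word in the generators evaluate to the Y of its
    slash graph, and [slash_seq] is a bijection from words of atomic partitions to set partitions
    ([slash_seq_inj], [atomic_decompK]). Evaluation therefore carries the words of each degree
    bijectively to the basis of that degree, and distinct degrees do not interact because they live
    on words of distinct lengths ([homogeneous_eq0]). *)

Section SignedSums.
Local Open Scope ring_scope.

(** * Signed counts of edge sets that join every vertex to a root set *)

Lemma big_powersetD1 (I : finType) (e : I) (D : {set I}) (f : {set I} -> rat) :
  e \in D ->
  \sum_(S in powerset D) f S =
  \sum_(S in powerset (D :\ e)) f S + \sum_(S in powerset (D :\ e)) f (e |: S).
Proof.
move=> eD; rewrite (bigID (fun S : {set I} => e \in S)) /= addrC; congr (_ + _).
  by apply: eq_bigl => S; rewrite !powersetE subsetD1.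
rewrite (reindex_onto (fun S => e |: S) (fun S => S :\ e)) /=; last first.
  by move=> S /andP[_ eS]; rewrite setD1K.
apply: eq_bigl => S; rewrite !powersetE subUset sub1set eD setU11 /= andbT.
rewrite subsetD1; congr andb; apply/eqP/idP => [<-|/setU1K //].
by rewrite !inE eqxx.
Qed.

Lemma sum_sign_powerset (I : finType) (D : {set I}) :
  \sum_(S in powerset D) (-1) ^+ #|S| = (D == set0)%:R :> rat.
Proof.
have [->|/set0Pn[e eD]] := eqVneq D set0.
  by rewrite powerset0 big_set1 cards0.
rewrite (big_powersetD1 _ eD) -big_split big1 // => S; rewrite powersetE subsetD1.
by case/andP=> _ eS; rewrite cardsU1 eS exprS mulN1r /= subrr.
Qed.

Variable T : finType.
Implicit Types (R U : {set T}) (S D : {set T * T}) (e : T * T).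

Definition crosses U e := (e.1 \in U) != (e.2 \in U).

(** Cut form of: every vertex is joined to [R] by edges of [S], orientation ignored. Contracting an
    edge that leaves [R] then only enlarges [R], and the vertex type stays fixed. *)
Definition reaches R S :=
  [forall U : {set T}, (R \subset U) ==> (U != setT) ==> [exists e in S, crosses U e]].

Lemma reachesP R S :
  reflect (forall U : {set T}, R \subset U -> U != setT -> 
             exists2 e, e \in S & crosses U e)
          (reaches R S).
Proof.
apply: (iffP forallP) => h U.
  by move=> RU UT; have := h U; rewrite RU UT => /exists_inP.
by apply/implyP => RU; apply/implyP => UT; apply/exists_inP; exact: h.
Qed.

(** For [R] nonempty and [D] reaching every vertex, this is up to sign the Tutte polynomial at (1,0)
    of the graph with [R] identified to one point. *)
Definition reach_sum R D : rat :=
  \sum_(S in powerset D) (-1) ^+ #|S| * (reaches R S)%:R.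

Lemma crossesP U e : crosses U e ->
  exists v, [/\ v \notin U, (e.1 \in v |: U) && (e.2 \in v |: U) &
                forall W : {set T}, U \subset W -> crosses W e = (v \notin W)].
Proof.
rewrite /crosses; case: (boolP (e.1 \in U)) => h1; case: (boolP (e.2 \in U)) => h2 // _.
  exists e.2; split=> //; rewrite ?inE ?h1 ?eqxx ?orbT // => W.
  move=> /fintype.subsetP/(_ _ h1) ->.
  by case: (_ \in _).
exists e.1; split=> //; rewrite ?inE ?h2 ?eqxx ?orbT // => W.
move=> /fintype.subsetP/(_ _ h2) ->.
by case: (_ \in _).
Qed.

(** A cut that misses [v] is crossed by [e] itself, and a cut that contains [v] never is; so adding
    [e] to the edges amounts to adding [v] to the roots. *)
Lemma reaches_contract R S v e : e \notin S ->
  (e.1 \in v |: R) && (e.2 \in v |: R) ->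
  (forall W : {set T}, R \subset W -> crosses W e = (v \notin W)) ->
  reaches R (e |: S) = reaches (v |: R) S.
Proof.
move=> eS /andP[e1 e2] ce; apply/reachesP/reachesP => h U.
  rewrite subUset sub1set => /andP[vU RU] UT.
  have [f] := h _ RU UT; rewrite !inE => /predU1P[->|fS cf]; last by exists f.
  by rewrite ce // vU.
move=> RU UT; have [vU|vU] := boolP (v \in U); last first.
  by exists e; rewrite ?setU11 // ce.
have [|f fS cf] := h U _ UT; first by rewrite subUset sub1set vU.
by exists f => //; rewrite inE fS orbT.
Qed.

Lemma reach_sum_rec R D v e : e \in D ->
  (e.1 \in v |: R) && (e.2 \in v |: R) ->
  (forall W : {set T}, R \subset W -> crosses W e = (v \notin W)) ->
  reach_sum R D = reach_sum R (D :\ e) - reach_sum (v |: R) (D :\ e).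
Proof.
move=> eD e12 ce; rewrite /reach_sum (big_powersetD1 _ eD) -sumrN; congr (_ + _).
apply: eq_bigr => S; rewrite powersetE subsetD1 => /andP[_ eS].
by rewrite (reaches_contract eS e12 ce) cardsU1 eS exprS mulN1r mulNr.
Qed.

Lemma cardsCU1 R v : v \notin R -> #|~: R| = #|~: (v |: R)|.+1.
Proof. by move=> vR; rewrite (cardsD1 v) inE vR setDE setCU setIC. Qed.

(** Unless [R] is everything, [R] itself is a cut that no subset of [D] crosses; if it is
    everything, all subsets count and their signs cancel unless [D] is empty. *)
Lemma reach_sum_stuck R D : (forall e, e \in D -> ~~ crosses R e) ->
  reach_sum R D = ((R == setT) && (D == set0))%:R.
Proof.
move=> nc; have [->|RT] := eqVneq R setT.
  rewrite -sum_sign_powerset; apply: eq_bigr => S _.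
  suff -> : reaches setT S by rewrite mulr1.
  by apply/reachesP => U; rewrite subTset => ->.
rewrite /reach_sum big1 // => S; rewrite powersetE => /fintype.subsetP SD.
case: reachesP => [/(_ _ (subxx R) RT)[e /SD /nc/negP//]|_]; exact: mulr0.
Qed.

(** Contraction enters [reach_sum_rec] with a minus sign and also lowers the exponent by one, so
    both terms of the recursion contribute nonnegatively. *)
Lemma reach_sum_ge0 R D : 0 <= (-1) ^+ #|~: R| * reach_sum R D.
Proof.
have [n] := ubnP #|D|; elim: n R D => // n IH R D /ltnSE Dn.
have [/exists_inP[e eD cRe]|/exists_inPn nc] := boolP [exists e in D, crosses R e].
  have [v [vR e12 ce]] := crossesP cRe.
  have Den : (#|D :\ e| < n)%N by rewrite (cardsD1 e) eD in Dn.
  rewrite (reach_sum_rec eD e12 ce) mulrBr addr_ge0 ?IH //.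
  by rewrite (cardsCU1 vR) exprS mulN1r mulNr opprK IH.
rewrite reach_sum_stuck //; case: eqP => [->|_]; last by rewrite mulr0.
by rewrite setCT cards0 mul1r ler0n.
Qed.

(* Deletion-contraction on an edge [e] leaving [R]: if [e] has a parallel edge*)
(* modulo [R], deleting [e] preserves reachability; otherwise contracting [e] *)
(* creates no loop.                                                           *)
Lemma reach_sum_gt0 R D : reaches R D ->
  (forall e, e \in D -> e.1 != e.2) ->
  (forall e, e \in D -> ~~ ((e.1 \in R) && (e.2 \in R))) ->
  0 < (-1) ^+ #|~: R| * reach_sum R D.
Proof.
have [n] := ubnP #|D|; elim: n R D => // n IH R D /ltnSE Dn RD nd nl.
have [RT|RT] := eqVneq R setT.
  suff D0 : D = set0.
    by rewrite reach_sum_stuck ?RT ?D0 ?setCT ?cards0 ?eqxx ?mul1r // => e; rewrite inE.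
  by apply/eqP/set0Pn => -[e /nl]; rewrite RT !inE.
have [e eD cRe] := reachesP _ _ RD _ (subxx R) RT.
have [v [vR e12 ce]] := crossesP cRe.
have Den : (#|D :\ e| < n)%N by rewrite (cardsD1 e) eD in Dn.
have nde f : f \in D :\ e -> f.1 != f.2 by case/setD1P=> _ /nd.
rewrite (reach_sum_rec eD e12 ce) mulrBr -mulNr -mulN1r.
rewrite {2}(cardsCU1 vR) exprS !mulN1r opprK.
have [/exists_inP[f fD f12]|/exists_inPn nf] :=
  boolP [exists f in D :\ e, (f.1 \in v |: R) && (f.2 \in v |: R)].
  apply: ltr_wpDr; first exact: reach_sum_ge0.
  apply: IH => // [|g /setD1P[_]]; last exact: nl.
  apply/reachesP => U RU UT; have [vU|vU] := boolP (v \in U).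
    have [g gD cg] := reachesP _ _ RD _ RU UT; exists g => //.
    by rewrite !inE gD andbT; apply: contraTneq cg => ->; rewrite ce // vU.
  (* The endpoints of [f] lie in [v |: R], differ and are not both in [R], so [f] joins [v] to [R]
     and crosses any [U] that contains [R] but not [v]. *)
  exists f => //; have := nde f fD; have := nl f.
  move: fD f12; rewrite !inE => /andP[_ fD] h /(_ fD).
  have RUP x : x \in R -> x \in U := fintype.subsetP RU x.
  move: h; rewrite /crosses.
  have [->|_] := eqVneq f.1 v; have [->|_] := eqVneq f.2 v => //=; rewrite ?eqxx //.
  - by move=> /RUP -> _; rewrite (negbTE vU).
  - by rewrite andbT => /RUP -> _; rewrite (negbTE vU).
  - by move=> ->.
apply: ltr_wpDl; first exact: reach_sum_ge0.
by apply: IH => //; rewrite -(reaches_contract _ e12 ce) ?setD1K ?setD11.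
Qed.

End SignedSums.

(** * Connectivity and edge sets *)

Section Connect.
Variable T : finType.
Implicit Types (e r : rel T) (S : {set T * T}).

Lemma connect_min e r : reflexive r -> transitive r -> subrel e r ->
  subrel (connect e) r.
Proof.
move=> rr tr er x y /connectP[p]; elim: p x => [|z p IH] x /=; first by move=> _ ->.
by case/andP=> /er xz pz yE; apply: tr xz _; exact: IH.
Qed.

Definition edge_rel S : rel T := [rel x y | ((x, y) \in S) || ((y, x) \in S)].

Lemma edge_rel_sym S : symmetric (edge_rel S).
Proof. by move=> x y; rewrite /edge_rel /= orbC. Qed.

Lemma edge_connect_sym S : connect_sym (edge_rel S).
Proof. exact/sym_connect_sym/edge_rel_sym. Qed.

Lemma connect_equivalence e : symmetric e -> equivalence_rel (connect e).
Proof.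
move=> /sym_connect_sym se; split; first exact: connect0.
by move=> xy; apply: same_connect.
Qed.

End Connect.

(** * Set partitions as equivalence relations, refinement, and components *)

Section SetPartitions.
Variable n : nat.
Implicit Types (p q : setpart n) (x y : 'I_n) (r : rel 'I_n).

Definition same p : rel 'I_n := fun x y => y \in pblock (val p) x.

Lemma eq_setpart p q : same p =2 same q -> p = q.
Proof.
move=> pq; apply: val_inj; rewrite -(equivalence_partition_pblock (valP p)).
rewrite -(equivalence_partition_pblock (valP q)).
by apply: eq_imset => x; apply/setP => y; rewrite !inE; exact: pq.
Qed.

Lemma rel_partition r (er : equivalence_rel r) :
  partition (equivalence_partition r [set: 'I_n]) [set: 'I_n].
Proof. by apply: equivalence_partitionP => x y z _ _ _; exact: er. Qed.

Definition rel_part r (er : equivalence_rel r) : setpart n :=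
  exist _ (equivalence_partition r [set: 'I_n]) (rel_partition er).

Lemma same_equivalence_partition r p : equivalence_rel r ->
  val p = equivalence_partition r [set: 'I_n] -> same p =2 r.
Proof. by move=> er pE x y; rewrite /same pE pblock_equivalence_partition ?inE. Qed.

Lemma same_rel_part r (er : equivalence_rel r) : same (rel_part er) =2 r.
Proof. exact: same_equivalence_partition. Qed.

Lemma same_comp_part (H : sgraph n) : same (comp_part H) =2 connect H.
Proof.
by apply: same_equivalence_partition => //; apply: connect_equivalence; exact: adj_sym.
Qed.

Lemma same_equivalence p : equivalence_rel (same p).
Proof.
have /and3P[/eqP cP tP _] := valP p.
have xP x : x \in cover (val p) by rewrite cP inE.
move=> x y z; rewrite /same; split; first by rewrite mem_pblock.
by rewrite -(eq_pblock _ tP) // => /eqP ->.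
Qed.

Lemma samexx p : reflexive (same p).
Proof. by move=> x; have [] := same_equivalence p x x x. Qed.

Lemma same_left p x y z : same p x y -> same p x z = same p y z.
Proof. by have [_] := same_equivalence p x y z. Qed.

Lemma same_sym p : symmetric (same p).
Proof.
have s x y : same p x y -> same p y x by move=> xy; rewrite -(same_left _ xy) samexx.
by move=> x y; apply/idP/idP; exact: s.
Qed.

Lemma same_trans p : transitive (same p).
Proof. by move=> y x z xy; rewrite (same_left _ xy). Qed.

Lemma ker_equivalence (k : {ffun 'I_n -> nat}) :
  equivalence_rel (fun x y => k x == k y).
Proof. by move=> x y z; split=> // /eqP ->. Qed.

Definition ker_part (k : {ffun 'I_n -> nat}) : setpart n :=
  rel_part (ker_equivalence k).

Lemma same_ker k x y : same (ker_part k) x y = (k x == k y).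
Proof. exact: same_rel_part. Qed.

(** A colouring whose kernel is [p]: each block is coloured by its rank among all subsets. *)
Definition block_word p : {ffun 'I_n -> nat} :=
  [ffun x => enum_rank (pblock (val p) x) : nat].

Lemma block_wordK p : ker_part (block_word p) = p.
Proof.
apply: eq_setpart => x y; rewrite same_ker !ffunE.
have -> : (enum_rank (pblock (val p) x) == enum_rank (pblock (val p) y) :> nat) =
          (enum_rank (pblock (val p) x) == enum_rank (pblock (val p) y)) by [].
rewrite (inj_eq enum_rank_inj).
have /and3P[/eqP cP tP _] := valP p.
by rewrite eq_pblock // cP inE.
Qed.

Definition refines p q := [forall x, forall y, same p x y ==> same q x y].

Lemma refinesP p q : reflect (subrel (same p) (same q)) (refines p q).
Proof.
by apply: (iffP 'forall_'forall_implyP) => h x y; exact: h.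
Qed.

Lemma refines_refl p : refines p p.
Proof. exact/refinesP. Qed.

(** A numerical rank that grows strictly along proper refinement; it orders the triangular systems
    of [proper_indep]. *)
Definition nsame p := #|[set xy : 'I_n * 'I_n | same p xy.1 xy.2]|.

Lemma refines_nsame p q : refines p q -> p != q -> (nsame p < nsame q)%N.
Proof.
move=> /refinesP pq npq; apply: proper_card; rewrite properE; apply/andP; split.
  by apply/fintype.subsetP => -[x y]; rewrite !inE; exact: pq.
apply: contra npq => /fintype.subsetP qp; apply/eqP/eq_setpart => x y.
by apply/idP/idP => [/pq//|qxy]; have := qp (x, y); rewrite !inE; exact.
Qed.

Lemma leq_nsame p : (nsame p <= n * n)%N.
Proof. by rewrite -{2}(card_ord n) -{1}(card_ord n) -card_prod max_card. Qed.

Definition edges_part (S : {set 'I_n * 'I_n}) : setpart n :=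
  rel_part (connect_equivalence (edge_rel_sym S)).

Lemma same_edges_part S : same (edges_part S) =2 connect (edge_rel S).
Proof. exact: same_rel_part. Qed.

Lemma edges_part_refines S p :
  refines (edges_part S) p = (S \subset [set e | same p e.1 e.2]).
Proof.
apply/refinesP/fintype.subsetP => [h [x y] xyS|h x y].
  by rewrite inE; apply: h; rewrite same_edges_part connect1 // /edge_rel /= xyS.
rewrite same_edges_part; apply: connect_min => [||a b /=].
- exact: samexx.
- exact: same_trans.
- by case/orP=> /h; rewrite inE //= same_sym.
Qed.

Variable H : sgraph n.

(** Each undirected edge is listed once, so that (-1)^|S| has its usual meaning. *)
Definition edges := [set e : 'I_n * 'I_n | H e.1 e.2 & (e.1 < e.2)%N].

Lemma edge_rel_edges : edge_rel edges =2 H.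
Proof.
move=> x y; rewrite /edge_rel /= !inE /= [H y x]adj_sym -andb_orr.
rewrite -neq_ltn andb_idr // => Hxy.
by apply: contraTneq Hxy => /val_inj ->; rewrite adj_irr.
Qed.

Lemma edges_part_edges : edges_part edges = comp_part H.
Proof.
apply: eq_setpart => x y; rewrite same_comp_part same_edges_part.
exact/eq_connect/edge_rel_edges.
Qed.

Let root_set := [set x | fingraph.root H x == x].

Let cH : connect_sym H. Proof. exact/sym_connect_sym/adj_sym. Qed.

Let edges_connect (S : {set 'I_n * 'I_n}) : S \subset edges ->
  subrel (connect (edge_rel S)) (connect H).
Proof.
move=> /fintype.subsetP SE; apply: connect_sub => x y xy; apply: connect1.
by rewrite -edge_rel_edges /edge_rel /=; case/orP: xy => /SE ->; rewrite ?orbT.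
Qed.

(* One root per component of [H]: with this choice, [S] reaches every vertex  *)
(* exactly when it has the components of [H], and no edge of [H] is a loop    *)
(* modulo the roots.                                                          *)
Lemma edges_part_eq (S : {set 'I_n * 'I_n}) : S \subset edges ->
  (edges_part S == comp_part H) = reaches root_set S.
Proof.
move=> SE; apply/eqP/reachesP => [SH U RU|h].
  (* An uncrossed [U] is a union of components of [S], which are those of [H]; each contains its
     root, which lies in [U], so [U] is everything. *)
  move=> UT; apply/exists_inP; apply: contraNT UT => /exists_inPn nc.
  have Uc : closed (edge_rel S) U.
    by move=> x y /orP[] /nc; rewrite /crosses negbK => /eqP.
  apply/eqP/setP => x; rewrite inE.
  have := same_edges_part S (fingraph.root H x) x.
  rewrite SH same_comp_part cH connect_root.
  move=> /esym/(closed_connect Uc) <-; apply: (fintype.subsetP RU).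
  by rewrite inE (root_root cH).
(* The vertices that [S] joins to their own root: this set contains the roots, and no edge of [S]
   crosses it. *)
pose U := [set z | connect (edge_rel S) (fingraph.root H z) z].
have hU : U = setT.
  have [//|UT] := eqVneq U setT; have [|e eS] := h _ _ UT.
    by apply/fintype.subsetP => z; rewrite !inE => /eqP ->; exact: connect0.
  have e12 : edge_rel S e.1 e.2 by rewrite /edge_rel /= -surjective_pairing eS.
  have /(fingraph.rootP cH) r12 := edges_connect SE (connect1 e12).
  by rewrite /crosses !inE r12 (same_connect_r (edge_connect_sym S) (connect1 e12)) eqxx.
apply: eq_setpart => x y; rewrite same_comp_part same_edges_part.
apply/idP/idP; first exact: edges_connect.
have hz z : connect (edge_rel S) (fingraph.root H z) z.
  by have := in_setT z; rewrite -hU inE.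
rewrite -(root_connect cH) => /eqP xy; apply: connect_trans (hz y).
by rewrite edge_connect_sym -xy.
Qed.

End SetPartitions.

(** * Power sum coefficients and triangularity *)

Section PowerSumCoefficients.
Local Open Scope ring_scope.
Variable n : nat.
Implicit Types (H : sgraph n) (p q : setpart n) (k : {ffun 'I_n -> nat}).

(* The coefficient of the power sum indexed by [p] in the chromatic function  *)
(* of [H], see [properE].                                                     *)
Definition psum_coef H p : rat :=
  \sum_(S in powerset (edges H) | edges_part S == p) (-1) ^+ #|S|.

Lemma psum_coef_refines H p : psum_coef H p != 0 -> refines p (comp_part H).
Proof.
apply: contraNT => np; rewrite /psum_coef big1 // => S /andP[].
rewrite powersetE => SE /eqP pE; case/negP: np; rewrite -pE -edges_part_edges.
rewrite edges_part_refines; apply: fintype.subset_trans SE _.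
by rewrite -edges_part_refines refines_refl.
Qed.

(** By [edges_part_eq] this coefficient is the [reach_sum] of the root set over all edges, and
    [reach_sum_gt0] applies. *)
Lemma psum_coef_comp_part H : psum_coef H (comp_part H) != 0.
Proof.
have cH : connect_sym H by exact/sym_connect_sym/adj_sym.
rewrite /psum_coef big_mkcondr /=.
set R := [set x | fingraph.root H x == x].
have -> : \sum_(S in powerset (edges H))
    (if edges_part S == comp_part H then (-1) ^+ #|S| else 0)
  = reach_sum R (edges H).
  apply: eq_bigr => S; rewrite powersetE => SE.
  by rewrite edges_part_eq // -/R; case: reaches; rewrite ?mulr1 ?mulr0.
suff : 0 < (-1) ^+ #|~: R| * reach_sum R (edges H).
  by apply: contraTneq => ->; rewrite mulr0 ltxx.
apply: reach_sum_gt0.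
- by rewrite -edges_part_eq // edges_part_edges.
- by move=> e; rewrite inE => /andP[_]; apply: contraTneq => ->; rewrite ltnn.
- move=> e; rewrite !inE => /andP[He _]; apply/negP => /andP[/eqP r1 /eqP r2].
  (* Adjacent roots share a component, hence coincide, and the edge would be a loop. *)
  have /(fingraph.rootP cH) r12 := connect1 He.
  by move: He; rewrite -r1 r12 r2 adj_irr.
Qed.

Definition properb H k := [forall u, forall v, H u v ==> (k u != k v)].

Lemma properbP H k : reflect (proper_colouring H k) (properb H k).
Proof.
apply: (iffP 'forall_'forall_implyP) => h u v Huv; first exact/eqP/h.
exact/eqP/h.
Qed.

(** The alternating sum over sets of monochromatic edges is 1 if there are none and 0 otherwise. All
    edges of [S] are monochromatic exactly when [edges_part S] refines the kernel of [k]; the sum is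
    then grouped by [edges_part S]. *)
Lemma properE H k :
  (properb H k)%:R = \sum_p psum_coef H p * (refines p (ker_part k))%:R.
Proof.
pose B := [set e : 'I_n * 'I_n | same (ker_part k) e.1 e.2].
transitivity (\sum_(S in powerset (edges H :&: B)) (-1) ^+ #|S| : rat).
  rewrite sum_sign_powerset; congr ((_ : bool)%:R); apply/idP/eqP => [/properbP pk|EB0].
    apply/setP => e; rewrite !inE same_ker; apply/negP => /andP[/andP[/pk He _]].
    by move/eqP.
  apply/'forall_'forall_implyP => u v; rewrite -edge_rel_edges.
  have nE e : e \in edges H -> k e.1 != k e.2.
    move=> eE; have : e \notin edges H :&: B by rewrite EB0 inE.
    by rewrite inE eE inE same_ker.
  by case/orP => /nE //=; rewrite eq_sym.
rewrite [RHS](eq_bigr (fun p => \sum_(S in powerset (edges H) | edges_part S == p)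
    (-1) ^+ #|S| * (S \subset B)%:R)); last first.
  move=> p _; rewrite mulr_suml; apply: eq_bigr => S /andP[_ /eqP <-].
  by rewrite edges_part_refines.
rewrite -(partition_big (@edges_part n) xpredT) //=.
rewrite [RHS](bigID (fun S : {set 'I_n * 'I_n} => S \subset B)) /=.
rewrite [X in _ + X]big1 ?addr0.
  apply: eq_big => S; first by rewrite !powersetE subsetI.
  by rewrite powersetE subsetI => /andP[_ ->]; rewrite mulr1.
by move=> S /andP[_ /negbTE ->]; rewrite mulr0.
Qed.

(** Strong induction on [h j]: in column [j] every off-diagonal nonzero entry belongs to an [i]
    whose coefficient is already known to vanish. *)
Lemma triangular_indep (I : finType) (h : I -> nat) (M : I -> I -> rat) :
  (forall i, M i i != 0) -> (forall i j, M i j != 0 -> i != j -> (h i < h j)%N) ->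
  forall c : I -> rat, (forall j, \sum_i c i * M i j = 0) -> forall i, c i = 0.
Proof.
move=> Mii Mij c cM j; have [m] := ubnP (h j); elim: m j => // m IH j /ltnSE hj.
move: (cM j); rewrite (bigD1 j) //= big1 ?addr0.
  by move/eqP; rewrite mulf_eq0 (negbTE (Mii j)) orbF => /eqP.
move=> i ij; have [->|/Mij/(_ ij) lij] := eqVneq (M i j) 0; first by rewrite mulr0.
by rewrite IH ?mul0r //; exact: leq_trans hj.
Qed.

Lemma proper_indep (H : setpart n -> sgraph n) (c : setpart n -> rat) :
  (forall p, comp_part (H p) = p) ->
  (forall k, \sum_p c p * (properb (H p) k)%:R = 0) -> forall p, c p = 0.
Proof.
move=> HK c0.
(* The coefficient of the power sum at [q] in the whole combination. Evaluating at [block_word s]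
   gives the sum of [b q] over [q] refining [s], so all [b q] vanish. *)
pose b q := \sum_p c p * psum_coef (H p) q.
have b0 : forall q, b q = 0.
  apply: (triangular_indep (h := @nsame n) (M := fun q s => (refines q s)%:R)).
  - by move=> q; rewrite refines_refl oner_eq0.
  - by move=> q s; case: (boolP (refines q s)) => // qs _; exact: refines_nsame.
  move=> s; rewrite -[RHS](c0 (block_word s)).
  rewrite [RHS](eq_bigr (fun p => \sum_q c p * psum_coef (H p) q * (refines q s)%:R)).
    by rewrite exchange_big; apply: eq_bigr => q _; rewrite mulr_suml.
  move=> p _; rewrite properE block_wordK mulr_sumr.
  by apply: eq_bigr => q _; rewrite mulrA.
(* Here nonzero entries have [q] refining [p], the opposite direction, so the rank is reversed;
   [leq_nsame] keeps the subtraction from truncating. *)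
apply: (triangular_indep (h := fun p => (n * n - nsame p)%N)
         (M := fun p => psum_coef (H p))) => //.
- by move=> p; rewrite -{2}(HK p) psum_coef_comp_part.
- move=> p q /psum_coef_refines; rewrite HK eq_sym => qp /(refines_nsame qp) lt.
  by rewrite ltn_sub2l // (leq_trans lt) // leq_nsame.
Qed.

End PowerSumCoefficients.

(** * Coefficients of the series on words *)

Section Words.
Local Open Scope ring_scope.
Variable n : nat.
Implicit Types (H : sgraph n) (p q : setpart n) (k : {ffun 'I_n -> nat}) (w : seq nat).

Definition word_fun w : {ffun 'I_n -> nat} := [ffun j : 'I_n => nth 0%N w j].

Lemma word_funK w : size w = n -> [seq word_fun w j | j <- enum 'I_n] = w.
Proof.
move=> wn; apply: (@eq_from_nth _ 0%N); first by rewrite size_map size_enum_ord.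
move=> i; rewrite size_map size_enum_ord => lin.
by rewrite (nth_map (Ordinal lin)) ?size_enum_ord // ffunE nth_enum_ord.
Qed.

Lemma fun_wordK k : word_fun [seq k j | j <- enum 'I_n] = k.
Proof.
by apply/ffunP => j; rewrite ffunE (nth_map j) ?size_enum_ord // nth_ord_enum.
Qed.

(** A word of length [n] is the monomial of exactly one function, [word_fun w], so at most one term
    of the sum survives at [w]. *)
Lemma nc_sum_words (A : set {ffun 'I_n -> nat}) w :
  nc_sum A (fun k => nc_monomial [seq k j | j <- enum 'I_n]) w =
  ((size w == n) && `[< A (word_fun w) >])%:R.
Proof.
rewrite /nc_sum /nc_monomial.
have [wn|wn] := eqVneq (size w) n; last first.
  rewrite fsbig1 // => k _; case: eqP => // wE.
  by move: wn; rewrite wE size_map size_enum_ord eqxx.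
have kw k : (w == [seq k j | j <- enum 'I_n]) -> k = word_fun w.
  by move=> /eqP ->; rewrite fun_wordK.
case: asboolP => Aw; last first.
  by rewrite fsbig1 // => k Ak; case: eqP => // /eqP/kw kE; case: Aw; rewrite -kE.
rewrite -(fsbig_widen [set word_fun w]%classic A) /= ?fsbig_set1 ?word_funK ?eqxx //.
  by move=> k ->.
by move=> k [_ nk] /=; case: eqP => // /eqP/kw.
Qed.

Lemma chromYE H w : chromY H w = ((size w == n) && properb H (word_fun w))%:R.
Proof.
by rewrite /chromY nc_sum_words; congr ((_ && _)%:R); apply/asboolP/properbP.
Qed.

Lemma mpartE p w : mpart p w = ((size w == n) && (ker_part (word_fun w) == p))%:R.
Proof.
rewrite /mpart nc_sum_words; congr ((_ && _)%:R); apply/asboolP/eqP => [h|<- j k].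
  apply: eq_setpart => x y; rewrite same_ker.
  by apply/eqP/idP => /h.
by have := same_ker (word_fun w) j k; rewrite /same => ->; split=> /eqP.
Qed.

Lemma proper_ker H k : properb H k =
  [forall u, forall v, H u v ==> ~~ same (ker_part k) u v].
Proof.
by apply: eq_forallb => u; apply: eq_forallb => v; rewrite same_ker.
Qed.

Lemma ncseries_sumE (I : Type) (r : seq I) (P : pred I) (F : I -> ncseries) w :
  (\sum_(i <- r | P i) F i) w = \sum_(i <- r | P i) F i w.
Proof. exact: (big_morph (fun f : ncseries => f w)). Qed.

Lemma chromY_indep (H : setpart n -> sgraph n) :
  (forall p, comp_part (H p) = p) -> lin_indep (fun p => chromY (H p)).
Proof.
move=> HK c c0; apply: (proper_indep HK) => k.
have /(congr1 (fun f : ncseries => f [seq k j | j <- enum 'I_n])) := c0.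
rewrite ncseries_sumE => e; apply: etrans e; apply: eq_bigr => p _.
have -> : (c p *: chromY (H p)) [seq k j | j <- enum 'I_n] =
  c p * chromY (H p) [seq k j | j <- enum 'I_n] by [].
by rewrite chromYE size_map size_enum_ord eqxx fun_wordK.
Qed.

Lemma chromY_mpart H : chromY H =
  \sum_p [forall u, forall v, H u v ==> ~~ same p u v]%:R *: mpart p.
Proof.
apply/funext => w; rewrite ncseries_sumE chromYE proper_ker.
set q := ker_part _.
transitivity (\sum_p [forall u, forall v, H u v ==> ~~ same p u v]%:R *
                      mpart p w) => //.
rewrite (bigD1 q) //= big1 ?addr0; last first.
  by move=> p pq; rewrite mpartE -/q [q == p]eq_sym (negbTE pq) andbF mulr0.
rewrite mpartE eqxx andbT andbC.
by case: (size w == n); rewrite ?mulr1 ?mulr0 ?andbT ?andbF.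
Qed.

End Words.

(** * Independence forces equality of spans *)

Section Linear.
Local Open Scope ring_scope.
Variables (V : lmodType rat) (I : finType).

(** The transition matrix from [v] to [w] is square, and a vector in its left kernel is a relation
    among the [v i]; so it is invertible. *)
Lemma lin_span_eq (v w : I -> V) : (forall i, exists c, v i = \sum_j c j *: w j) ->
  lin_indep v -> lin_span v = lin_span w.
Proof.
move=> /boolp.choice[A vA] iv.
pose M : 'M[rat]_#|I| := \matrix_(i, j) A (enum_val i) (enum_val j).
have vE (c : I -> rat) : \sum_i c i *: v i = \sum_j (\sum_i c i * A i j) *: w j.
  under eq_bigr do rewrite vA scaler_sumr.
  rewrite exchange_big; apply: eq_bigr => j _; rewrite scaler_suml.
  by apply: eq_bigr => i _; rewrite scalerA.
have uM : M \in unitmx.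
  rewrite -row_free_unit -kermx_eq0; apply/rowV0P => x /sub_kermxP xM.
  have x0 : forall i, x 0 (enum_rank i) = 0.
    apply: iv; rewrite vE big1 // => j _.
    have /rowP/(_ (enum_rank j)) := xM; rewrite !mxE => e.
    rewrite (_ : \sum_i _ = 0) ?scale0r // -[RHS]e (reindex enum_rank) /=.
      by apply: eq_bigr => i _; rewrite mxE !enum_rankK.
    by apply: onW_bij; exact: enum_rank_bij.
  by apply/rowP => i; rewrite mxE -(enum_valK i) x0.
apply/seteqP; split => _ [c _ <-].
  by exists (fun j => \sum_i c i * A i j); rewrite // vE.
pose x := (\row_i c (enum_val i)) *m invmx M.
exists (fun i => x 0 (enum_rank i)) => //; rewrite vE; apply: eq_bigr => j _.
congr (_ *: _).
have /rowP/(_ (enum_rank j)) : x *m M = \row_i c (enum_val i) by rewrite mulmxKV.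
rewrite !mxE enum_rankK => <-; rewrite [RHS](reindex enum_rank) /=.
  by apply: eq_bigr => i _; rewrite [M _ _]mxE !enum_rankK.
by apply: onW_bij; exact: enum_rank_bij.
Qed.

End Linear.

(** * Multiplicativity of Y under slash products *)

Section Slash.
Local Open Scope ring_scope.

Lemma slash_adjE m k (G : sgraph m) (H : sgraph k) :
  [/\ forall a b, slash_graph G H (lshift k a) (lshift k b) = G a b,
      forall a b, slash_graph G H (rshift m a) (rshift m b) = H a b,
      forall a b, slash_graph G H (lshift k a) (rshift m b) = false &
      forall a b, slash_graph G H (rshift m a) (lshift k b) = false].
Proof.
by split=> a b; rewrite /= /slash_adj -?[lshift k _]/(unsplit (inl _))
  -?[rshift m _]/(unsplit (inr _)) !unsplitK.
Qed.

(** In the product only the cut of the word at position [m] contributes, by length; there,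
    properness splits because no edge joins the two parts. *)
Lemma chromY_slash m k (G : sgraph m) (H : sgraph k) :
  chromY (slash_graph G H) = chromY G * chromY H.
Proof.
have [Gll Grr Glr Grl] := slash_adjE G H.
apply/funext => w.
rewrite -[RHS]/(\sum_(i < (size w).+1) chromY G (take i w) * chromY H (drop i w)).
rewrite chromYE; have [wE|wE] := eqVneq (size w) (m + k)%N; last first.
  rewrite big1 // => i _; rewrite !chromYE size_take_min size_drop.
  case: eqP => [im|_]; last by rewrite mul0r.
  case: eqP => [ik|_]; last by rewrite mulr0.
  have iw : (i <= size w)%N by rewrite -ltnS.
  have : size w = (m + k)%N by rewrite -im -ik (minn_idPl iw) subnKC.
  by move/eqP; rewrite (negbTE wE).
have mw : (m < (size w).+1)%N by rewrite ltnS wE leq_addr.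
rewrite (bigD1 (Ordinal mw)) //= big1 ?addr0; last first.
  move=> i im; have iw : (i <= size w)%N by rewrite -ltnS.
  rewrite chromYE size_take_min (minn_idPl iw).
  suff /negbTE -> : (i : nat) != m by rewrite mul0r.
  by apply: contra im => /eqP im; apply/eqP/val_inj.
rewrite !chromYE size_take_min size_drop wE (minn_idPl (leq_addr _ _)) addKn !eqxx /=.
rewrite -natrM mulnb; congr ((_ : bool)%:R).
have wl a : word_fun (m + k) w (lshift k a) = word_fun m (take m w) a.
  by rewrite !ffunE nth_take.
have wr a : word_fun (m + k) w (rshift m a) = word_fun k (drop m w) a.
  by rewrite !ffunE nth_drop.
apply/properbP/andP => [h|[/properbP h1 /properbP h2] u v].
  split; apply/properbP => a b ab.
    by rewrite -!wl; apply: h; rewrite Gll.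
  by rewrite -!wr; apply: h; rewrite Grr.
case: (split_ordP u) => a ->; case: (split_ordP v) => b ->.
- by rewrite Gll !wl; exact: h1.
- by rewrite Glr.
- by rewrite Grl.
- by rewrite Grr !wr; exact: h2.
Qed.

Lemma chromY_empty : chromY empty_graph = 1.
Proof.
apply/funext => w; rewrite chromYE -[RHS]/((w == [::])%:R : rat) -size_eq0.
by case: eqP => //= _; case: properbP => // -[] [].
Qed.

Lemma chromY_seq_graph (G : forall a : atomic_part, sgraph (asize a)) s :
  chromY (seq_graph G s) = \prod_(a <- s) chromY (G a).
Proof.
elim: s => [|a s IH] /=; first by rewrite big_nil chromY_empty.
by rewrite chromY_slash IH big_cons.
Qed.

End Slash.

(** * Unique atomic factorization, and components of slash graphs *)

Section Factorization.
Local Open Scope nat_scope.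
Implicit Types p q : partn.

(** Block membership on plain numbers, so that partitions whose sizes are only provably equal can be
    compared without casts. *)
Definition same_nat p (i j : nat) : bool :=
  [exists x : 'I_(tag p), exists y : 'I_(tag p),
     [&& val x == i, val y == j & same (tagged p) x y]].

Lemma same_natE p (x y : 'I_(tag p)) : same_nat p x y = same (tagged p) x y.
Proof.
apply/existsP/idP => [[u /existsP[v /and3P[/eqP/val_inj -> /eqP/val_inj -> //]]]|xy].
by exists x; apply/existsP; exists y; rewrite !eqxx.
Qed.

Lemma same_nat_lt p i j : same_nat p i j -> (i < tag p) && (j < tag p).
Proof. by case/existsP=> u /existsP[v /and3P[/eqP <- /eqP <- _]]; rewrite !ltn_ord. Qed.

Lemma eq_partn p q :
  tag p = tag q ->
  (forall i j, i < tag p -> j < tag p -> same_nat p i j = same_nat q i j) -> p = q.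
Proof.
case: p q => n p [m q] /= nm; subst m => pq; congr existT; apply: eq_setpart => x y.
have := pq x y (ltn_ord x) (ltn_ord y).
by rewrite (@same_natE (existT setpart n p)) (@same_natE (existT setpart n q)).
Qed.

Lemma same_blockP p x y : reflect (exists B, [/\ B \in val (tagged p), x \in B & y \in B])
  (same (tagged p) x y).
Proof.
have /and3P[/eqP cP tP _] := valP (tagged p).
apply: (iffP idP) => [xy|[B [BP xB yB]]]; last by rewrite /same (def_pblock tP BP).
exists (pblock (val (tagged p)) x).
by rewrite pblock_mem ?mem_pblock ?cP ?inE.
Qed.

Lemma same_nat_slash p q i j : same_nat (slash p q) i j =
  same_nat p i j || [&& tag p <= i, tag p <= j & same_nat q (i - tag p) (j - tag p)].
Proof.
pose lsh := @lshift (tag p) (tag q); pose rsh := @rshift (tag p) (tag q).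
apply/idP/orP => [/existsP[x /existsP[y /and3P[/eqP <- /eqP <-]]]|[|]].
- case/same_blockP => B [/setUP[]/imsetP[C CP ->]] /imsetP[u uC ->] /imsetP[v vC ->].
    by left; rewrite same_natE; apply/same_blockP; exists C.
  right; rewrite /= !leq_addr !addKn same_natE; apply/same_blockP; by exists C.
- case/existsP=> u /existsP[v /and3P[/eqP <- /eqP <-]] /same_blockP[C [CP uC vC]].
  rewrite (@same_natE (slash p q) (lsh u) (lsh v)); apply/same_blockP.
  by exists (lsh @: C); rewrite !imset_f // inE imset_f.
- case/and3P=> pi pj /existsP[u /existsP[v /and3P[/eqP ui /eqP vj]]].
  case/same_blockP=> C [CP uC vC]; rewrite -(subnKC pi) -(subnKC pj) -ui -vj.
  rewrite (@same_natE (slash p q) (rsh u) (rsh v)); apply/same_blockP.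
  exists (rsh @: C); rewrite !imset_f // inE.
  by rewrite (imset_f (fun B : {set 'I_(tag q)} => rsh @: B)) ?orbT.
Qed.

Lemma slash_inj p q p' q' : slash p q = slash p' q' -> tag p = tag p' ->
  p = p' /\ q = q'.
Proof.
move=> pq tp; have tq : tag q = tag q'.
  by have /(congr1 (@tag _ _))/= := pq; rewrite tp => /addnI.
have sE i j : same_nat (slash p q) i j = same_nat (slash p' q') i j by rewrite pq.
split; apply: eq_partn => // i j li lj.
  have := sE i j; rewrite !same_nat_slash -tp.
  by rewrite !(leqNgt _ i) li /= !orbF.
have := sE (tag p + i) (tag p + j); rewrite !same_nat_slash -tp !leq_addr !addKn /=.
have nl r a b : tag r = tag p -> same_nat r (tag p + a) b = false.
  by move=> rp; apply/negbTE/negP => /same_nat_lt; rewrite rp ltnNge leq_addr.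
by rewrite !nl.
Qed.

(** No block of the common product straddles position [tag p], so [p'] splits there; [t] is the
    restriction of [p'] to the later positions, shifted down. *)
Lemma slash_prefix p q p' q' : slash p q = slash p' q' -> tag p < tag p' ->
  exists t, 0 < tag t /\ p' = slash p t.
Proof.
move=> pq lp; pose m := tag p' - tag p.
have shP (i : 'I_m) : tag p + i < tag p' by rewrite -ltn_subRL.
pose sh i := Ordinal (shP i).
have er : equivalence_rel (fun i j : 'I_m => same (tagged p') (sh i) (sh j)).
  by move=> x y z; exact: same_equivalence.
exists (existT setpart m (rel_part er)); split; first by rewrite /= subn_gt0.
have tE : tag p' = tag (slash p (existT setpart m (rel_part er))).
  by rewrite /= subnKC // ltnW.
apply: eq_partn => // i j li lj.
rewrite same_nat_slash.
have sE a b : same_nat (slash p q) a b = same_nat (slash p' q') a b by rewrite pq.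
have := sE i j; rewrite !same_nat_slash.
rewrite [tag p' <= i]leqNgt li /= orbF => <-; congr orb.
have [pi|pi] := leqP (tag p) i => //=; have [pj|pj] := leqP (tag p) j => //=.
have hi : i - tag p < m by rewrite ltn_sub2r.
have hj : j - tag p < m by rewrite ltn_sub2r.
rewrite (@same_natE (existT setpart m (rel_part er)) (Ordinal hi) (Ordinal hj)).
rewrite same_rel_part -same_natE /= !subnKC //.
have := sE i j; rewrite !same_nat_slash.
rewrite [tag p' <= i]leqNgt li /= orbF => <-.
rewrite pi pj; case: (boolP (same_nat p i j)) => //= /same_nat_lt.
by rewrite ltnNge pi.
Qed.

(** First factors of different sizes would, by [slash_prefix], split the longer one, against
    atomicity; with equal sizes they cancel. *)
Lemma slash_seq_inj : injective slash_seq.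
Proof.
have pos (a : atomic_part) : 0 < tag (val a).
  by have /asboolP[] := valP a.
have nlt (a b : atomic_part) p q :
    slash (val a) p = slash (val b) q -> ~~ (tag (val a) < tag (val b)).
  move=> ab; apply/negP => /(slash_prefix ab)[t [t0 bE]].
  by have /asboolP[_ /(_ _ _ (pos a) t0)] := valP b.
elim=> [|a s IH] [|b t] //= st.
- have := congr1 (@tag _ _) st => /= /eqP; rewrite eq_sym addn_eq0.
  by rewrite (gtn_eqF (pos b)).
- have := congr1 (@tag _ _) st => /= /eqP; rewrite addn_eq0.
  by rewrite (gtn_eqF (pos a)).
- have [|/val_inj -> /IH -> //] := slash_inj st.
  apply/eqP; rewrite eqn_leq leqNgt (nlt _ _ _ _ (esym st)) /=.
  by rewrite leqNgt (nlt _ _ _ _ st).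
Qed.

Lemma slash_seqK : cancel slash_seq atomic_decomp.
Proof. by move=> s; apply: slash_seq_inj; rewrite atomic_decompK. Qed.

Lemma comp_part_slash m k (G : sgraph m) (H : sgraph k) :
  existT setpart (m + k) (comp_part (slash_graph G H)) =
  slash (existT setpart m (comp_part G)) (existT setpart k (comp_part H)).
Proof.
have [Gll Grr Glr Grl] := slash_adjE G H.
(* The disjoint sum of the two connectivity relations, shown to be the connectivity of the slash
   graph. *)
pose r (u v : 'I_(m + k)) := match fintype.split u, fintype.split v with
   | inl a, inl b => connect G a b | inr a, inr b => connect H a b | _, _ => false end.
have rll a b : r (lshift k a) (lshift k b) = connect G a b.
  by rewrite /r -!/(unsplit (inl _)) !unsplitK.
have rrr a b : r (rshift m a) (rshift m b) = connect H a b.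
  by rewrite /r -!/(unsplit (inr _)) !unsplitK.
have rlr a b : r (lshift k a) (rshift m b) = false.
  by rewrite /r -/(unsplit (inl _)) -/(unsplit (inr _)) !unsplitK.
have rrl a b : r (rshift m a) (lshift k b) = false.
  by rewrite /r -/(unsplit (inl _)) -/(unsplit (inr _)) !unsplitK.
have cr : connect (slash_graph G H) =2 r.
  move=> u v; apply/idP/idP.
    apply: connect_min.
    - by move=> x; rewrite /r; case: fintype.split => a; exact: connect0.
    - move=> y x z; rewrite /r; case: (fintype.split x) => a;
      case: (fintype.split y) => b; case: (fintype.split z) => c //; exact: connect_trans.
    - move=> x y; rewrite /= /slash_adj /r; case: fintype.split => a;
      by case: fintype.split => b // ab; exact: connect1.
  case: (split_ordP u) => a ->; case: (split_ordP v) => b ->; rewrite ?rlr ?rrl //.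
    rewrite rll; apply: (connect_min
      (r := [rel a b | connect (slash_graph G H) (lshift k a) (lshift k b)])).
    - by move=> x; exact: connect0.
    - by move=> x y z; exact: connect_trans.
    - by move=> x y xy; apply: connect1; rewrite Gll.
  rewrite rrr; apply: (connect_min
    (r := [rel a b | connect (slash_graph G H) (rshift m a) (rshift m b)])).
  - by move=> x; exact: connect0.
  - by move=> x y z; exact: connect_trans.
  - by move=> x y xy; apply: connect1; rewrite Grr.
congr existT; apply: eq_setpart => u v; rewrite same_comp_part cr.
set p := existT _ m _; set q := existT _ k _.
rewrite -[RHS](@same_natE (slash p q)) same_nat_slash.
case: (split_ordP u) => a ->; case: (split_ordP v) => b ->.
- rewrite rll /= [(m <= a)%N]leqNgt ltn_ord orbF (@same_natE p).
  by rewrite same_comp_part.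
- rewrite rlr /= [(m <= a)%N]leqNgt ltn_ord orbF.
  by apply/esym/negbTE/negP => /same_nat_lt /andP[_]; rewrite /= ltnNge leq_addr.
- rewrite rrl /= [(m <= b)%N]leqNgt ltn_ord andbF orbF.
  by apply/esym/negbTE/negP => /same_nat_lt; rewrite /= ltnNge leq_addr.
- rewrite rrr /= !leq_addr !addKn (@same_natE q) same_comp_part.
  case: (boolP (same_nat p _ _)) => // /same_nat_lt.
  by rewrite /= ltnNge leq_addr.
Qed.

Lemma comp_part_empty : existT setpart 0 (comp_part empty_graph) = empty_part.
Proof. by apply: eq_partn. Qed.

Lemma comp_part_seq_graph (G : forall a : atomic_part, sgraph (asize a)) s :
  (forall a, comp_part (G a) = apart a) ->
  existT setpart _ (comp_part (seq_graph G s)) = slash_seq s.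
Proof.
move=> hG; elim: s => [|a s IH] /=; first exact: comp_part_empty.
rewrite comp_part_slash IH hG; congr slash.
Qed.

End Factorization.

(** * The basis of each degree and free generation *)

Section FreeGeneration.
Local Open Scope ring_scope.

Lemma NCSym_degD n f g : NCSym_deg n f -> NCSym_deg n g -> NCSym_deg n (f + g).
Proof.
case: n => [|n] [a _ <-] [b _ <-].
  by exists (a + b) => //; rewrite scalerDl.
exists (fun p => a p + b p) => //; rewrite -big_split.
by apply: eq_bigr => p _; rewrite scalerDl.
Qed.

Lemma NCSym_degZ n (c : rat) f : NCSym_deg n f -> NCSym_deg n (c *: f).
Proof.
case: n => [|n] [a _ <-].
  by exists (c * a) => //; rewrite scalerA.
exists (fun p => c * a p) => //; rewrite scaler_sumr.
by apply: eq_bigr => p _; rewrite scalerA.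
Qed.

Lemma NCSym_deg0 n : NCSym_deg n 0.
Proof.
case: n => [|n]; first by exists 0 => //; rewrite scale0r.
by exists (fun=> 0) => //; rewrite big1 // => p _; rewrite scale0r.
Qed.

Lemma NCSym_deg_chromY n (H : sgraph n) : NCSym_deg n (chromY H).
Proof.
case: n H => [|n] H; last by rewrite chromY_mpart; exists (fun p =>
  [forall u, forall v, H u v ==> ~~ same p u v]%:R).
exists 1 => //; rewrite scale1r -chromY_empty; apply/funext => w.
rewrite !chromYE; case: (size w == 0%N) => //=.
by case: properbP => [_|[] []//]; case: properbP => [|[] []].
Qed.

Lemma sum_existT n (s : partn) (v : ncseries) : tag s = n ->
  \sum_(q : setpart n | s == existT setpart n q) v = v.
Proof.
case: s => m q /= mn; subst m; rewrite (eq_bigl (pred1 q)) ?big_pred1_eq // => s /=.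
by rewrite -tag_eqE /tag_eq /= eqxx tagged_asE eq_sym.
Qed.

Variable G : forall a : atomic_part, sgraph (asize a).
Hypothesis hG : forall a : atomic_part, comp_part (G a) = apart a.
Let y a := chromY (G a).

(** The vertex count of [extend_graph G q] equals [tag q] only by [atomic_decompK]; this transports
    the graph to the right type. *)
Lemma extend_graph_retype (q : partn) : exists H : sgraph (tag q),
  comp_part H = tagged q /\ chromY H = chromY (extend_graph G q).
Proof.
have : existT setpart _ (comp_part (extend_graph G q)) = q.
  by rewrite -[RHS]atomic_decompK; exact: comp_part_seq_graph.
move: (tag (slash_seq _)) (extend_graph G q) => m K; case: _ /.
by exists K.
Qed.

Lemma extend_graph_family n : exists H : setpart n -> sgraph n, forall p,
  comp_part (H p) = p /\ chromY (H p) = chromY (extend_graph G (existT setpart n p)).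
Proof.
have ex (p : setpart n) : exists H : sgraph n,
    comp_part H = p /\ chromY H = chromY (extend_graph G (existT setpart n p)).
  exact: (extend_graph_retype (existT setpart n p)).
by have [H HP] := boolp.choice ex; exists H.
Qed.

(** Includes [n = 0], which [chromY_alg_indep] uses for constant terms. *)
Lemma extend_graph_indep n :
  lin_indep (fun p : setpart n => chromY (extend_graph G (existT setpart n p))).
Proof.
have [H HP] := extend_graph_family n.
move=> c c0; apply: (@chromY_indep _ H) => [p|]; first by case: (HP p).
by rewrite -[RHS]c0; apply: eq_bigr => p _; have [_ ->] := HP p.
Qed.

Lemma extend_graph_basis n : (0 < n)%N ->
  is_basis (fun p : setpart n => chromY (extend_graph G (existT setpart n p)))
           (NCSym_deg n).
Proof.
move=> n0; split; first exact: extend_graph_indep.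
rewrite (_ : NCSym_deg n = lin_span (@mpart n)); last by case: n n0.
apply: lin_span_eq; last exact: extend_graph_indep.
move=> p; have [H HP] := extend_graph_family n; have [_ <-] := HP p.
by rewrite chromY_mpart; eexists.
Qed.

Lemma nc_evalE p : nc_eval y p =
  \sum_(w <- msupp p) p@_w *: chromY (seq_graph G (fmonom_val w)).
Proof.
rewrite /nc_eval mmapE; apply: eq_bigr => w _.
by rewrite /= mulr_algl chromY_seq_graph.
Qed.

Let degree (w : {fmonom atomic_part}) := tag (slash_seq (fmonom_val w)).

(** The Y of a graph on d vertices is supported on words of length d, so testing on words of length
    [n] isolates the terms of degree [n]. *)
Lemma homogeneous_eq0 p n : nc_eval y p = 0 ->
  \sum_(w <- msupp p | degree w == n) p@_w *: chromY (seq_graph G (fmonom_val w)) = 0.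
Proof.
rewrite nc_evalE => p0; apply/funext => v; rewrite ncseries_sumE.
have vE (c : rat) w : degree w != size v ->
    (c *: chromY (seq_graph G (fmonom_val w))) v = 0.
  move=> wv; rewrite -[LHS]/(c * chromY (seq_graph G (fmonom_val w)) v).
  by rewrite chromYE eq_sym (negbTE wv) mulr0.
have [vn|vn] := eqVneq (size v) n; last first.
  by rewrite big1 // => w /eqP wn; rewrite vE // wn eq_sym.
have /(congr1 (fun f : ncseries => f v)) := p0.
rewrite ncseries_sumE (bigID (fun w => degree w == n)) /= [X in _ + X]big1 ?addr0 //.
by move=> w wn; rewrite vE // vn.
Qed.

Lemma chromY_alg_indep : alg_indep y.
Proof.
move=> p p0; apply/malgP => w0; rewrite mcoeff0.
have [w0r|/mcoeff_outdom //] := boolP (w0 \in msupp p).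
pose n := degree w0.
(* Collects the coefficients of [p] by the partition a word multiplies to. By [slash_seq_inj] the
   class of [w0] is [w0] alone, so its sum is the coefficient of [w0]. *)
pose c (q : setpart n) :=
  \sum_(w <- msupp p | slash_seq (fmonom_val w) == existT setpart n q) p@_w.
suff c0 : \sum_q c q *: chromY (extend_graph G (existT setpart n q)) = 0.
  have := extend_graph_indep c0 (tagged (slash_seq (fmonom_val w0))).
  rewrite /c (_ : existT _ _ _ = slash_seq (fmonom_val w0));
    last by rewrite /n /degree; case: slash_seq.
  rewrite (eq_bigl (pred1 w0)); last first.
    by move=> w /=; rewrite (inj_eq slash_seq_inj).
  by rewrite -big_filter filter_pred1_uniq ?fset_uniq // big_seq1.
rewrite -[RHS](homogeneous_eq0 n p0).
transitivity (\sum_q \sum_(w <- msupp p | slash_seq (fmonom_val w) == existT setpart n q)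
    p@_w *: chromY (seq_graph G (fmonom_val w))).
  apply: eq_bigr => q _; rewrite scaler_suml; apply: eq_bigr => w /eqP <-.
  by rewrite /extend_graph slash_seqK.
rewrite (exchange_big_dep (fun w => degree w == n)) /=; last first.
  by move=> q w _ /eqP; rewrite /degree => ->.
by apply: eq_bigr => w /eqP; exact: sum_existT.
Qed.

Lemma nc_eval_NCSym p : NCSym (nc_eval y p).
Proof.
pose N := (\max_(w <- msupp p) degree w).+1.
exists N, (fun n => \sum_(w <- msupp p | degree w == n)
  p@_w *: chromY (seq_graph G (fmonom_val w))); split.
  move=> n; apply: big_ind => [||w /eqP <-].
  - exact: NCSym_deg0.
  - exact: NCSym_degD.
  - by apply: NCSym_degZ; exact: NCSym_deg_chromY.
rewrite nc_evalE (exchange_big_dep xpredT) //= !big_seq; apply: eq_bigr => w wp.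
have wN : (degree w < N)%N by rewrite ltnS; exact: (leq_bigmax_seq (F := degree)).
by rewrite (big_pred1 (Ordinal wN)) // => i; rewrite eq_sym.
Qed.

(** In positive degree, [g] is expanded in the basis, and each basis element is the value of the
    word [atomic_decomp] of its index. *)
Lemma NCSym_deg_nc_eval n g : NCSym_deg n g -> exists p, nc_eval y p = g.
Proof.
case: n => [|n].
  by case=> c _ <-; exists (c%:A); rewrite linearZ /= rmorph1.
have [_ <-] := extend_graph_basis (ltn0Sn n) => -[c _ <-].
pose m (q : setpart n.+1) : {malg rat[{fmonom atomic_part}]} :=
  << FMonom (atomic_decomp (existT setpart n.+1 q)) >>.
exists (\sum_q c q *: m q); rewrite linear_sum; apply: eq_bigr => q _.
rewrite linearZ /= /m /nc_eval mmapU /= mulr_algl scale1r /nc_eval_word /=.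
by rewrite /extend_graph chromY_seq_graph.
Qed.

Lemma NCSym_nc_eval f : NCSym f -> exists p, nc_eval y p = f.
Proof.
case=> N [g [gn ->]]; elim: N => [|N [p pE]].
  by exists 0; rewrite linear0 big_ord0.
have [q qE] := NCSym_deg_nc_eval (gn N).
by exists (p + q); rewrite linearD /= pE qE big_ord_recr.
Qed.

Lemma chromY_freely_generate : freely_generate y NCSym.
Proof.
split => [p _|p q _ _ pq|f /NCSym_nc_eval[p <-]]; first exact: nc_eval_NCSym.
  apply/eqP; rewrite -subr_eq0; apply/eqP/chromY_alg_indep.
  by rewrite linearB /= pq subrr.
by exists p.
Qed.

End FreeGeneration.

Theorem theorem5p2 (G : forall a : atomic_part, sgraph (asize a))
    (hG : forall a : atomic_part, comp_part (G a) = apart a) :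
  (forall n : nat, (0 < n)%N ->
     is_basis (fun p : setpart n => chromY (extend_graph G (existT setpart n p)))
              (NCSym_deg n))
  /\ alg_indep (fun a : atomic_part => chromY (G a))
  /\ freely_generate (fun a : atomic_part => chromY (G a)) NCSym.
Proof.
split; first by move=> n; exact: extend_graph_basis.
by split; [exact: chromY_alg_indep | exact: chromY_freely_generate].
Qed.
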